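(* Let $\mathbb{K}$ be a field and let $G$ be a finite simple graph with $n$ vertices. Then for every integer $k\geq 1$, $${\rm reg}(J(G)^{(k)})\leq (k-1)\gamma(G)+n-\alpha_2(G).$$
   Context: For $V(G)=\{x_1,\ldots,x_n\}$, let $S=\mathbb{K}[x_1,\ldots,x_n]$. The cover ideal is $J(G)=\bigcap_{x_ix_j\in E(G)}(x_i,x_j)$ and its $k$-th symbolic power is $J(G)^{(k)}=\bigcap_{x_ix_j\in E(G)}(x_i,x_j)^k$ (both equal $S$ if $G$ has no edges). The regularity of a graded $S$-module $M$ is ${\rm reg}(M)=\max\{j-i\mid \beta_{i,j}(M)\neq 0\}$. For a set $A$ of vertices, $N_G(A)=\bigcup_{x\in A}N_G(x)$ and $N_G[A]=N_G(A)\cup A$; $G\setminus B$ denotes the graph obtained by deleting the vertices in $B$. Define $$\gamma(G)=\max\Big\{\tfrac{|V(G)|+|N_G(A)|-|A|}{2}\;\Big|\; A \text{ is a (possibly empty) independent set of } G \text{ and } G\setminus N_G[A] \text{ has no bipartite connected component}\Big\},$$ where an isolated vertex counts as a bipartite connected component and the graph with no vertices has no connected components. The star ${\rm St}(x)$ with center $x$ is the subgraph with vertex set $N_G[x]=N_G(x)\cup\{x\}$ and edge set $\{xy\mid y\in N_G(x)\}$. A star packing of $G$ is a family of stars ${\rm St}(x)$ (with distinct centers) whose vertex sets are pairwise disjoint, and $\alpha_2(G)$, the star packing number, is the maximum cardinality of a star packing of $G$. *)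

(* Defs.v *)
From HB Require Import structures.
From mathcomp Require Import all_boot all_order all_algebra.
From mathcomp.multinomials Require Import mpoly.

Set Implicit Arguments.
Unset Strict Implicit.
Unset Printing Implicit Defensive.

Import Order.TTheory GRing.Theory Num.Theory.
Local Open Scope ring_scope.

Section Ideals.
Variable R : comNzRingType.

Definition ideal_gen (A : R -> Prop) : R -> Prop := fun p =>
  exists m (g a : 'I_m -> R), (forall l, A (g l)) /\ p = \sum_l a l * g l.

(* For k = 0 the only product is the empty one, so I^0 = R. *)
Definition ideal_pow (I : R -> Prop) (k : nat) : R -> Prop :=
  ideal_gen (fun q => exists f : 'I_k -> R, (forall l, I (f l)) /\ q = \prod_l f l).

End Ideals.

Section Resolutions.
Variables (K : fieldType) (n : nat).
Local Notation S := {mpoly K[n]}.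

(* A graded chain of free modules ... -> F_1 -> F_0 -> S, where
   F_i = \bigoplus_(l < gf_rank i) S(- gf_shift i l). Elements are row vectors
   and maps act by multiplication on the right: gf_diff i : F_{i+1} -> F_i and
   gf_aug : F_0 -> S. Shifts are natural numbers because the generators
   occurring in a minimal resolution of an ideal of S have degree >= 0. *)
Record graded_free_chain := GradedFreeChain {
  gf_rank : nat -> nat;
  gf_shift : forall i, 'I_(gf_rank i) -> nat;
  gf_diff : forall i, 'M[S]_(gf_rank i.+1, gf_rank i);
  gf_aug : 'cV[S]_(gf_rank 0)
}.

(* Multiplication by p is a degree-0 map S(-b) -> S(-a). *)
Definition homog_shift (a b : nat) (p : S) : Prop :=
  forall m, m \in msupp p -> (mdeg m + a)%N = b.

(* F is a minimal graded free resolution 0 -> F_p -> ... -> F_0 -> I -> 0;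
   minimality is the condition im(F_{i+1} -> F_i) \subset (x_1, ..., x_n) F_i,
   i.e. the entries of the differentials have no constant term. *)
Record minimal_graded_free_resolution
    (I : S -> Prop) (F : graded_free_chain) : Prop := MinimalResolution {
  mgfr_finite : exists p, forall i, (p < i)%N -> gf_rank F i = 0%N;
  mgfr_diff_graded : forall i (l : 'I_(gf_rank F i.+1)) (l' : 'I_(gf_rank F i)),
    homog_shift (gf_shift l') (gf_shift l) (gf_diff F i l l');
  mgfr_aug_graded : forall l : 'I_(gf_rank F 0),
    homog_shift 0 (gf_shift l) (gf_aug F l 0);
  mgfr_aug_onto : forall p : S,
    I p <-> exists u : 'rV[S]_(gf_rank F 0), p = (u *m gf_aug F) 0 0;
  mgfr_exact0 : forall u : 'rV[S]_(gf_rank F 0),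
    u *m gf_aug F = 0 <->
    exists v : 'rV[S]_(gf_rank F 1), u = v *m gf_diff F 0;
  mgfr_exactS : forall i (u : 'rV[S]_(gf_rank F i.+1)),
    u *m gf_diff F i = 0 <->
    exists v : 'rV[S]_(gf_rank F i.+2), u = v *m gf_diff F i.+1;
  mgfr_minimal : forall i (l : 'I_(gf_rank F i.+1)) (l' : 'I_(gf_rank F i)),
    (gf_diff F i l l')@_(0%MM : 'X_{1..n}) = 0
}.

Definition graded_betti (F : graded_free_chain) (i j : nat) : nat :=
  #|[set l : 'I_(gf_rank F i) | gf_shift l == j]|.

(* reg(I) = r. Minimal graded free resolutions are unique up to isomorphism,
   hence the Betti numbers, and r, do not depend on F. *)
Definition is_regularity (I : S -> Prop) (r : int) : Prop :=
  exists F : graded_free_chain,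
    [/\ minimal_graded_free_resolution I F,
        exists i j, graded_betti F i j <> 0%N /\ r = j%:Z - i%:Z
      & forall i j, graded_betti F i j <> 0%N -> j%:Z - i%:Z <= r].

End Resolutions.

Section Graphs.
Variables (n : nat) (e : rel 'I_n).

Definition edge_prime (K : fieldType) (i j : 'I_n) : {mpoly K[n]} -> Prop :=
  ideal_gen (fun p => p = 'X_i \/ p = 'X_j).
Arguments edge_prime : clear implicits.

Definition cover_ideal_symbolic_power (K : fieldType) (k : nat) :
    {mpoly K[n]} -> Prop :=
  fun p => forall i j, e i j -> ideal_pow (edge_prime K i j) k p.

Definition open_nbhd (A : {set 'I_n}) : {set 'I_n} :=
  [set y | [exists x in A, e x y]].

Definition closed_nbhd (A : {set 'I_n}) : {set 'I_n} := open_nbhd A :|: A.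

Definition independent (A : {set 'I_n}) : bool :=
  [forall x in A, forall y in A, ~~ e x y].

Definition induced (W : {set 'I_n}) : rel 'I_n :=
  [rel x y | [&& x \in W, y \in W & e x y]].

(* For x in W, the connected component of x in the subgraph induced on W. *)
Definition component (W : {set 'I_n}) (x : 'I_n) : {set 'I_n} :=
  [set y | connect (induced W) x y].

Definition bipartite_on (C : {set 'I_n}) : bool :=
  [exists B : {set 'I_n},
    [forall x in C, forall y in C, e x y ==> ((x \in B) != (y \in B))]].

Definition no_bipartite_component (W : {set 'I_n}) : bool :=
  [forall x in W, ~~ bipartite_on (component W x)].

(* The maximum runs over a nonempty family (it contains every maximal
   independent set) of nonnegative numbers (#|A| <= n), so the default value 0
   of the iterated maximum is harmless. *)
Definition gamma : rat :=
  \big[Num.max/0]_(A : {set 'I_n} |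
        independent A && no_bipartite_component (~: closed_nbhd A))
     ((n%:R + #|open_nbhd A|%:R - #|A|%:R) / 2).

(* A star packing is given by the set of its centers; the vertex set of St(x)
   is closed_nbhd [set x]. *)
Definition star_packing (P : {set 'I_n}) : bool :=
  [forall x in P, forall y in P,
    (x != y) ==> [disjoint closed_nbhd [set x] & closed_nbhd [set y]]].

Definition star_packing_number : nat :=
  \max_(P : {set 'I_n} | star_packing P) #|P|.

End Graphs.

Arguments cover_ideal_symbolic_power {n} e K k _.

(* Main.v *)
Require Import Defs.
From HB Require Import structures.
From mathcomp Require Import all_boot all_order all_algebra.
From mathcomp.multinomials Require Import mpoly.
From mathcomp Require Import zify ring lra.

Set Implicit Arguments.
Unset Strict Implicit.
Unset Printing Implicit Defensive.

Import Order.TTheory GRing.Theory Num.Theory.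
Local Open Scope ring_scope.

(** Write J for the k-th symbolic power of the cover ideal.  A monomial X^a lies
    in J exactly when a_u + a_v >= k on every edge uv.  A nonzero Betti number in
    homological degree i and internal degree j forces nonzero Koszul homology of
    J in degree i and some multidegree a with |a| = j, hence nonzero simplicial
    homology, at faces with i vertices, of the upper Koszul complex
      K^a = { t : X^(a - t) is in J }.
    So it suffices to bound |a| - i for such a.

    From a resolution to Koszul homology.  Starting from a basis element of F_i,
    a diagram chase ([essential_cycle_shift]) trades one step down the resolution
    for one step up the Koszul complex, because the Koszul complex of a free
    module is exact in positive degrees and the resolution is minimal.  After i
    steps this yields a Koszul cycle with values in J that is not a boundary
    ([generator_not_acyclic]).  Koszul chains split by multidegree into simplicial
    chains ([simplicial_bd_strand]), and the strand of multidegree a of the Koszul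
    complex of J is the chain complex of K^a.

    The complexes K^a.  Let W be the set of vertices v with a_v > 0 such that all
    edges at v have a-sum > k, and let H be the graph on W of the edges with a-sum
    exactly k + 1.  Then K^a is the independence complex of H
    ([upper_koszul_cover]).  An isolated vertex of H makes it a cone, so every
    vertex of W has an H-neighbour when there is homology.  Moreover the
    independence complex has no homology at faces with fewer than |P| vertices
    when the closed neighbourhoods of the vertices of P are disjoint
    ([acyclic_ind_complex_packing]); thus i >= |P :&: W| for every star packing P.

    The degree bound.  Let Z be the zero set of a.  Put x = 0 on Z, x = a - 1 on
    N(Z) and on W, and x = a - 1/2 on the remaining set T.  Then x has sum >= k - 1
    on every edge, and every vertex is a zero of x or lies on an edge with sum
    exactly k - 1.  Averaging half-integral roundings of such a point shows
    |x| <= (k - 1) gamma ([tight_cover_le_gamma]).  Finally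
    |a| = |x| + |N(Z)| + |W| + |T|/2, while a star packing P satisfies
    |P| <= |Z| + |T|/2 + |P :&: W|: a star centred in Z or N(Z) meets Z, and a star
    centred in T contains at least two vertices of T. *)

(** * Alternating boundary operators *)

Definition sgn_ins (R : comNzRingType) n (v : 'I_n) (t : {set 'I_n}) : R :=
  (-1) ^+ #|[set u in t | (u < v)%N]|.
Arguments sgn_ins {R n} v t.

Lemma sgn_ins_sqr (R : comNzRingType) n (v : 'I_n) (t : {set 'I_n}) :
  sgn_ins v t * sgn_ins v t = 1 :> R.
Proof. by rewrite /sgn_ins -expr2 sqrr_sign. Qed.

Lemma sgn_insU (R : comNzRingType) n (u v : 'I_n) (t : {set 'I_n}) : v \notin t ->
  sgn_ins u (v |: t) = (-1) ^+ (v < u)%N * sgn_ins u t :> R.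
Proof.
move=> vt; rewrite /sgn_ins -exprD; congr (_ ^+ _).
case: (ltnP v u) => vu.
  have -> : [set w in v |: t | (w < u)%N] = v |: [set w in t | (w < u)%N].
    by apply/setP=> w; rewrite !inE; case: eqP => // ->; rewrite vu.
  by rewrite cardsU1 inE (negbTE vt).
suff -> : [set w in v |: t | (w < u)%N] = [set w in t | (w < u)%N] by [].
by apply/setP=> w; rewrite !inE; case: eqP => // ->; rewrite (negbTE vt) ltnNge vu.
Qed.

Lemma sgn_ins_anti (R : comNzRingType) n (u v : 'I_n) (t : {set 'I_n}) :
  u != v -> u \notin t -> v \notin t ->
  sgn_ins v t * sgn_ins u (v |: t) = - (sgn_ins u t * sgn_ins v (u |: t)) :> R.
Proof.
move=> uv ut vt; rewrite !sgn_insU //.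
have : nat_of_ord u != v by [].
by case: ltngtP => // _ _; rewrite expr0 expr1; ring.
Qed.

Section Boundary.
Variables (R : comNzRingType) (n : nat) (M : lmodType R) (x : 'I_n -> R).
Implicit Types (f g : {set 'I_n} -> M) (t : {set 'I_n}) (v w : 'I_n).

(** With weights x = 1 this is the simplicial boundary of chains on subsets of
    'I_n; with x_v the variables of a polynomial ring it is the Koszul
    differential, f t being the coefficient of the wedge of the e_v, v in t.  Both
    uses share the sign bookkeeping. *)
Definition boundary f t : M := \sum_(v | v \notin t) (sgn_ins v t * x v) *: f (v |: t).

Lemma eq_boundary f g : f =1 g -> boundary f =1 boundary g.
Proof. by move=> fg t; apply: eq_bigr => v _; rewrite fg. Qed.

Lemma boundaryB f g t : boundary (fun s => f s - g s) t = boundary f t - boundary g t.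
Proof. by rewrite /boundary -sumrB; apply: eq_bigr => v _; rewrite scalerBr. Qed.

Lemma boundaryD f g t : boundary (fun s => f s + g s) t = boundary f t + boundary g t.
Proof. by rewrite /boundary -big_split; apply: eq_bigr => v _; rewrite scalerDr. Qed.

Lemma boundary0 f t : (forall s, f s = 0) -> boundary f t = 0.
Proof. by move=> f0; rewrite /boundary big1 // => v _; rewrite f0 scaler0. Qed.

Lemma boundary_boundary f t : boundary (boundary f) t = 0.
Proof.
pose F u v := (sgn_ins u t * x u * (sgn_ins v (u |: t) * x v)) *: f (v |: (u |: t)).
pose c u v := (u \notin t) && (v \notin t).
have FN u v : c u v && (u < v)%N -> F u v = - F v u.
  case/andP=> /andP[ut vt] uv; have uv' : u != v by rewrite -val_eqE /= neq_ltn uv.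
  rewrite /F -scaleNr; congr (_ *: f _); last by rewrite setUCA.
  have E := sgn_ins_anti R uv' ut vt.
  have -> : sgn_ins u t * x u * (sgn_ins v (u |: t) * x v) =
    (sgn_ins u t * sgn_ins v (u |: t)) * (x u * x v) by ring.
  rewrite -[X in X * _]opprK -E; ring.
have -> : boundary (boundary f) t =
    \sum_u \sum_(v | c u v && (u < v)%N) F u v
    + \sum_u \sum_(v | c u v && (v < u)%N) F u v.
  rewrite {1}/boundary big_mkcond -big_split; apply: eq_bigr => u _ /=.
  case: (boolP (u \in t)) => ut /=.
    by rewrite !big_pred0 ?addr0 // => v; rewrite /c ut.
  rewrite /boundary scaler_sumr !(big_mkcond _ (F u)) -big_split big_mkcond /=.
  apply: eq_bigr => v _; rewrite /F !inE /c ut negb_or -val_eqE /= scalerA.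
  by case: ltngtP => //=; case: (v \in t); rewrite /= ?addr0 ?add0r.
rewrite [X in _ + X](exchange_big_dep predT) //= -big_split big1 //= => u _.
rewrite [X in _ + X](eq_bigl (fun v => c u v && (u < v)%N)); last first.
  by move=> v; rewrite /c [X in X && _]andbC.
by rewrite (eq_bigr (fun v => - F v u)) ?sumrN ?addNr // => v; apply: FN.
Qed.

Definition cone w f t : M :=
  if w \in t then sgn_ins w (t :\ w) *: f (t :\ w) else 0.

(** Exterior multiplication by e_w is a null-homotopy of multiplication by x_w;
    all acyclicity statements below rest on it. *)
Lemma cone_homotopy w f t :
  boundary (cone w f) t + cone w (boundary f) t = x w *: f t.
Proof.
rewrite {2}/cone; case: (boolP (w \in t)) => wt; last first.
  rewrite addr0 /boundary (bigD1 w) //= big1 ?addr0; last first.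
    by move=> v /andP[vt vw]; rewrite /cone !inE eq_sym (negbTE vw) (negbTE wt) scaler0.
  rewrite /cone setU11 setU1K // scalerA mulrAC sgn_ins_sqr mul1r //.
set r := t :\ w; have wr : w \notin r by rewrite !inE eqxx.
have tE : t = w |: r by rewrite setD1K.
rewrite {2}/boundary (bigD1 w) //= -tE scalerDr scalerA mulrA sgn_ins_sqr mul1r.
rewrite addrCA -[RHS]addr0; congr (_ + _).
rewrite scaler_sumr /boundary.
rewrite [X in _ + X](eq_bigl (fun v => v \notin t)); last first.
  by move=> v; rewrite !inE negb_and negbK; case: eqP => [->|_] /=; rewrite ?wt ?andbT.
rewrite -big_split big1 //= => v vt.
have vw : v != w by apply: contraNneq vt => ->.
have vr : v \notin r by rewrite !inE (negbTE vt) andbF.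
rewrite /cone !inE wt orbT.
have -> : (v |: t) :\ w = v |: r.
  by apply/setP=> u; rewrite !inE; case: (u =P v) => // ->; rewrite vw.
rewrite !scalerA -scalerDl.
have : sgn_ins v t * sgn_ins w (v |: r) = - (sgn_ins w r * sgn_ins v r) :> R.
  rewrite -[LHS]mul1r -(sgn_ins_sqr R w r) mulrACA {1}tE sgn_ins_anti //.
  by rewrite mulNr mulrACA sgn_ins_sqr mulr1 mulrC.
move=> E; rewrite mulrAC E [sgn_ins w r * (_ * _)]mulrA mulNr addNr scale0r //.
Qed.

End Boundary.

(** * Acyclicity of simplicial complexes and independence complexes *)

Section Acyclicity.
Variables (K : fieldType) (n : nat).
Implicit Types (D : pred {set 'I_n}) (f g : {set 'I_n} -> K^o) (s t : {set 'I_n}) (w : 'I_n).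

(** Chains are indexed by the number p of vertices of a face, one more than its
    dimension, so that the empty face is included and homology is reduced. *)
Definition chain_on D p f := forall t, f t != 0 -> D t && (#|t| == p).

Definition simplicial_bd f t : K^o := boundary (fun=> 1) f t.

Definition acyclic_at D p := forall f, chain_on D p f -> (forall t, simplicial_bd f t = 0) ->
  exists2 g, chain_on D p.+1 g & simplicial_bd g =1 f.

Lemma simplicial_bd_cone w f t : simplicial_bd (cone w f) t = f t - cone w (simplicial_bd f) t.
Proof. by rewrite -[in RHS](scale1r (f t)) -(cone_homotopy (fun=> 1) w) addrK. Qed.

Lemma acyclic_at_empty D p : (forall t, ~~ D t) -> acyclic_at D p.
Proof.
move=> D0 f fD _; have f0 t : f t = 0.
  by apply: contraTeq (D0 t) => /fD /andP[]; rewrite negbK.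
by exists (fun=> 0) => [t|t]; rewrite ?eqxx ?f0 // /simplicial_bd boundary0.
Qed.

Lemma acyclic_at_cone D p w : (forall t, D t -> D (w |: t)) -> acyclic_at D p.
Proof.
move=> Dw f fD cf; exists (cone w f) => [t|t].
  rewrite /cone; case: ifP => wt; last by rewrite eqxx.
  move=> ft; have /fD/andP[Dt /eqP <-] : f (t :\ w) != 0.
    by apply: contraNneq ft => ->; rewrite scaler0.
  by rewrite -{1}(setD1K wt) Dw //= (cardsD1 w t) wt.
rewrite simplicial_bd_cone; have -> : cone w (simplicial_bd f) t = 0; last by rewrite subr0.
by rewrite /cone cf scaler0 if_same.
Qed.

(** The long exact sequence of deletion and link of a vertex w: a cycle is moved
    off w by filling its trace on the link, and what remains lives in the
    deletion. *)
Lemma acyclic_at_del_link D w q :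
    (forall s t, s \subset t -> D t -> D s) ->
    (forall p, (p < q)%N -> acyclic_at (fun t => (w \notin t) && D t) p) ->
    (forall p, (p.+1 < q)%N -> acyclic_at (fun t => (w \notin t) && D (w |: t)) p) ->
  forall p, (p < q)%N -> acyclic_at D p.
Proof.
move=> Ddown Ddel Dlink p pq f fD cf.
(* The trace of f on the link of w, and the part of f in the deletion. *)
pose l t : K^o := if w \notin t then sgn_ins w t *: f (w |: t) else 0.
pose f0 t : K^o := if w \notin t then f t else 0.
have fE t : f t = f0 t + cone w l t.
  rewrite /f0 /cone /l !inE eqxx; case: (boolP (w \in t)) => wt /=; last by rewrite addr0.
  by rewrite add0r scalerA sgn_ins_sqr scale1r setD1K.
have lE t : l t = - simplicial_bd f0 t.
  case: (boolP (w \in t)) => wt.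
    rewrite /l wt /= /simplicial_bd /boundary big1 ?oppr0 // => v _.
    by rewrite /f0 !inE wt orbT /= scaler0.
  apply/eqP; rewrite -addr_eq0 addrC; apply/eqP.
  have <- := cf t; rewrite [RHS](eq_boundary _ fE) boundaryD -/(simplicial_bd _ _)
    -/(simplicial_bd _ _).
  by rewrite simplicial_bd_cone [cone _ _ _]/cone (negbTE wt) subr0.
have cl t : simplicial_bd l t = 0.
  rewrite /simplicial_bd (eq_boundary _ lE) (eq_boundary _ (g := fun t => 0 - simplicial_bd
    f0 t)) => [|s].
    by rewrite boundaryB boundary_boundary boundary0 // subrr.
  by rewrite sub0r.
have [g1 g1D g1E] : exists2 g1,
    chain_on (fun t => (w \notin t) && D (w |: t)) p g1 & simplicial_bd g1 =1 l.
  have lD t : l t != 0 -> [&& w \notin t, D (w |: t) & #|t|.+1 == p].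
    rewrite /l; case: ifP => wt; last by rewrite eqxx.
    move=> ft; have /fD/andP[-> /eqP <-] : f (w |: t) != 0.
      by apply: contraNneq ft => ->; rewrite scaler0.
    by rewrite cardsU1 wt /=.
  case: p pq fD lD => [|p] pq fD lD.
    exists (fun=> 0) => [t|t]; first by rewrite eqxx.
    rewrite /simplicial_bd boundary0 //; apply/esym/eqP; apply: contraTT isT => /lD.
    by rewrite !andbF.
  by apply: Dlink => // t /lD /and3P[-> -> /eqP[->]] /=.
have [g0 g0D g0E] : exists2 g0,
    chain_on (fun t => (w \notin t) && D t) p.+1 g0 & simplicial_bd g0 =1 (fun t => f0 t +
      g1 t).
  apply: Ddel => // [t|t]; last by rewrite /simplicial_bd boundaryD -!/(simplicial_bd _ _)
    g1E lE addrN.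
  case: (boolP (g1 t == 0)) => [/eqP->|/g1D /andP[/andP[-> Dt] ->] _].
    by rewrite addr0 /f0; case: ifP => [_ /fD //|]; rewrite eqxx.
  by rewrite (Ddown t (w |: t)) // subsetUr.
exists (fun t => g0 t - cone w g1 t) => [t|t].
  case: (boolP (g0 t == 0)) => [/eqP->|/g0D /andP[/andP[_ -> ->]] //].
  rewrite sub0r oppr_eq0 /cone; case: ifP => wt; last by rewrite eqxx.
  move=> g1t; have /g1D/andP[/andP[_ Dt] /eqP <-] : g1 (t :\ w) != 0.
    by apply: contraNneq g1t => ->; rewrite scaler0.
  by rewrite -{1}(setD1K wt) Dt /= (cardsD1 w t) wt.
rewrite /simplicial_bd boundaryB -!/(simplicial_bd _ _) g0E simplicial_bd_cone fE opprB [_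
  - g1 t]addrC addrA addrK.
congr (_ + _); rewrite /cone; case: ifP => // _; by rewrite g1E.
Qed.

Definition ind_complex (h : rel 'I_n) (W t : {set 'I_n}) : bool :=
  (t \subset W) && independent h t.

Lemma eq_acyclic_at D D' p : D =1 D' -> acyclic_at D p -> acyclic_at D' p.
Proof.
move=> DD' aD f fD cf; have [|g gD gE] := aD f _ cf.
  by move=> t /fD; rewrite DD'.
by exists g => // t /gD; rewrite DD'.
Qed.

Lemma independentU1 (h : rel 'I_n) w t : ssrbool.symmetric h -> irreflexive h ->
  independent h (w |: t) = independent h t && [forall x in t, ~~ h w x].
Proof.
move=> hs hi; apply/idP/andP => [/'forall_implyP H|[/'forall_implyP H /'forall_implyP Hw]].
  have H2 x y : x \in w |: t -> y \in w |: t -> ~~ h x y.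
    by move=> /H /'forall_implyP; apply.
  split.
    by apply/'forall_implyP=> x xt; apply/'forall_implyP=> y yt; apply: H2;
      rewrite !inE ?xt ?yt orbT.
  by apply/'forall_implyP=> x xt; apply: H2; rewrite !inE ?eqxx ?xt ?orbT.
apply/'forall_implyP=> x; rewrite !inE => /orP[/eqP->|xt]; apply/'forall_implyP=> y;
  rewrite !inE => /orP[/eqP->|yt].
- by rewrite hi.
- exact: Hw.
- by rewrite hs; apply: Hw.
- by move/H/'forall_implyP: xt; apply.
Qed.

Lemma independentS (h : rel 'I_n) s t : s \subset t -> independent h t -> independent h s.
Proof.
move=> /subsetP st /'forall_implyP H; apply/'forall_implyP=> x /st /H /'forall_implyP H2.
by apply/'forall_implyP=> y /st /H2.
Qed.

Lemma acyclic_ind_complex_isolated (h : rel 'I_n) (W : {set 'I_n}) p v :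
    ssrbool.symmetric h -> irreflexive h -> v \in W -> {in W, forall u, ~~ h v u} ->
  acyclic_at (ind_complex h W) p.
Proof.
move=> hs hi vW iso; apply: (acyclic_at_cone (w := v)) => t /andP[tW It].
rewrite /ind_complex subUset sub1set vW tW independentU1 // It /=.
by apply/'forall_implyP=> x xt; apply/iso/(subsetP tW).
Qed.

(** Induction on W: if v in P has a neighbour w, removing w keeps the packing,
    and the link of w, the independence complex of W minus N[w], loses only the
    element v of P, in exchange for one vertex of the face.  If v has no neighbour,
    the complex is a cone. *)
Lemma acyclic_ind_complex_packing (h : rel 'I_n) (W P : {set 'I_n}) p :
    ssrbool.symmetric h -> irreflexive h -> P \subset W ->
    (forall u v w, u \in P -> v \in P -> w \in W ->
       (w == u) || h u w -> (w == v) || h v w -> u = v) ->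
  (p < #|P|)%N -> acyclic_at (ind_complex h W) p.
Proof.
move=> hs hi; have [m] := ubnP #|W|; elim: m => // m IH in W P p *.
rewrite ltnS => Wm /subsetP PW Ppack pP.
have [v vP] : exists v, v \in P by apply/set0Pn; rewrite -card_gt0; lia.
case: (boolP [exists w in W, h v w]) => [/'exists_andP[w [wW vw]]|]; last first.
  rewrite negb_exists => /forallP iso.
  apply: (acyclic_ind_complex_isolated (v := v)) => // [|u uW]; first exact: PW.
  by have := iso u; rewrite uW.
apply: (acyclic_at_del_link (w := w) (q := #|P|)) pP.
- move=> s t st /andP[tW It]; rewrite /ind_complex (subset_trans st tW).
  exact: independentS st It.
- move=> p' pP; apply: (@eq_acyclic_at (ind_complex h (W :\ w))).
    by move=> t; rewrite /ind_complex subsetD1 -andbA andbCA.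
  apply: (IH _ P) => //; first by rewrite (cardsD1 w W) wW in Wm.
    apply/subsetP=> u uP; rewrite !inE PW // andbT; apply: contraTneq (vw) => uw.
    rewrite uw in uP; have -> : v = w.
      by apply: (Ppack v w w) => //; rewrite ?eqxx ?vw ?orbT.
    by rewrite hi.
  by move=> a b c aP bP /setD1P[_ cW]; apply: Ppack.
- move=> p' pP; pose W' := [set u in W | (u != w) && ~~ h w u].
  apply: (@eq_acyclic_at (ind_complex h W')).
    move=> t; rewrite /ind_complex subUset sub1set wW independentU1 //=.
    apply/andP/and3P => [[tW It]|[wt tW /andP[It /'forall_implyP Hw]]]; split => //.
    + by apply/negP=> /(subsetP tW); rewrite !inE eqxx andbF.
    + by apply/subsetP=> u /(subsetP tW); rewrite inE => /andP[].
    + rewrite It; apply/'forall_implyP=> u /(subsetP tW); rewrite inE.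
      by case/and3P.
    + apply/subsetP=> u ut; rewrite inE (subsetP tW) //= Hw // andbT.
      by apply: contraNneq wt => <-.
  apply: (IH _ (P :\ v)).
  + apply: leq_trans Wm; rewrite (cardsD1 w W) wW ltnS; apply: subset_leq_card.
    by apply/subsetP=> u; rewrite !inE => /and3P[-> -> _].
  + apply/subsetP=> u /setD1P[uv uP]; rewrite inE PW //=.
    have wu : ~~ ((w == u) || h u w).
      apply: contraNN uv => wu; apply/eqP.
      by apply: (Ppack u v w) => //; rewrite vw orbT.
    by move: wu; rewrite negb_or eq_sym hs.
  + move=> a b c /setD1P[_ aP] /setD1P[_ bP]; rewrite inE => /andP[cW _].
    exact: Ppack.
  + by move: pP; rewrite (cardsD1 v P) vP.
Qed.

End Acyclicity.

(** * Koszul complexes of monomial ideals *)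

Section Koszul.
Variables (K : fieldType) (n : nat).
Local Notation S := {mpoly K[n]}.
Implicit Types (z w : {set 'I_n} -> S^o) (t : {set 'I_n}) (a m : 'X_{1..n}).

Definition koszul_bd (M : lmodType S) (z : {set 'I_n} -> M) t : M :=
  boundary (fun v => 'X_v : S) z t.

(** The squarefree monomial with support t, the multidegree of the wedge of the
    e_v, v in t. *)
Definition set_mnm t : 'X_{1..n} := [multinom (i \in t : nat) | i < n].

Lemma set_mnmU1 v t : v \notin t -> set_mnm (v |: t) = (set_mnm t + U_(v))%MM.
Proof.
move=> vt; apply/mnmP=> i; rewrite mnmDE !mnmE !inE eq_sym.
by case: eqP vt => [->|_] /negbTE vt; rewrite ?vt ?addn0.
Qed.

Lemma mdeg_set_mnm t : mdeg (set_mnm t) = #|t|.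
Proof.
rewrite mdegE -sum1_card [RHS]big_mkcond; apply: eq_bigr => i _.
by rewrite mnmE; case: (i \in t).
Qed.

(** The shift s makes the same definition serve each summand S(-s) of a graded
    free module: d is the total degree in the Koszul complex of S(-s), and Q
    restricts the coefficients to the span of a set of monomials. *)
Definition koszul_chain (Q : pred 'X_{1..n}) p s d z := forall t m,
  m \in msupp (z t) -> [/\ Q m, #|t| = p & (mdeg m + #|t| + s)%N = d].

(** The coefficients of z in multidegree a; only sets t with X^t dividing X^a
    contribute. *)
Definition strand z a t : K^o :=
  if (set_mnm t <= a)%MM then (z t)@_(a - set_mnm t) else 0.

Definition upper_koszul (Q : pred 'X_{1..n}) a t : bool :=
  (set_mnm t <= a)%MM && Q (a - set_mnm t)%MM.

Lemma mcoeff_XM (p : S) v m :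
  ('X_v * p)@_m = if (U_(v) <= m)%MM then p@_(m - U_(v)) else 0.
Proof.
rewrite mulrC; case: ifP => vm; first by rewrite -{1}(submK vm) addmC mcoeffMX.
apply/eqP; rewrite mcoeff_eq0 (perm_mem (msuppMX _ _)).
by apply/mapP=> -[m' _ mE]; move: vm; rewrite mE lem_addr.
Qed.

Lemma mcoeff_sgn_ins (p : S) v t m :
  (sgn_ins v t * p)@_m = sgn_ins v t * p@_m.
Proof.
by rewrite /sgn_ins -signr_odd -[in RHS]signr_odd; case: odd;
  rewrite ?expr1 ?expr0 ?mulN1r ?mul1r ?mcoeffN.
Qed.

Lemma simplicial_bd_strand z a t : simplicial_bd (strand z a) t = strand (koszul_bd z) a t.
Proof.
rewrite /strand /simplicial_bd /koszul_bd /boundary; case: ifP => ta; last first.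
  rewrite big1 // => v vt; case: ifP => vta; last by rewrite scaler0.
  by rewrite (lepm_trans _ vta) // set_mnmU1 // lem_addr in ta.
rewrite raddf_sum; apply: eq_bigr => v vt /=.
have -> : (sgn_ins v t * 'X_v : S) *: z (v |: t) = sgn_ins v t * ('X_v * z (v |: t)).
  by rewrite mulrA.
rewrite mcoeff_sgn_ins mcoeff_XM.
rewrite mulr1 -[LHS]/(_ * _); congr (_ * _).
have E : (set_mnm (v |: t) <= a)%MM = (U_(v) <= a - set_mnm t)%MM.
  rewrite set_mnmU1 //; apply/mnm_lepP/mnm_lepP => H i; have := H i;
  have := mnm_lepP ta i; rewrite !mnmDE !mnmBE; lia.
by rewrite E; case: ifP => // _; rewrite set_mnmU1 // -submDA.
Qed.

Lemma chain_strand Q p s d z a : koszul_chain Q p s d z ->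
  chain_on (upper_koszul Q a) p (strand z a).
Proof.
move=> zc t; rewrite /strand /upper_koszul; case: ifP => ta; last by rewrite eqxx.
by rewrite -mcoeff_msupp => /zc[-> -> _]; rewrite eqxx.
Qed.

(** Multidegrees do not interact, so fillings of the finitely many strands
    assemble to a Koszul chain. *)
Lemma koszul_boundary_of_strands Q p s d z :
    koszul_chain Q p s d z ->
    (forall a, (mdeg a + s)%N = d ->
       exists2 g, chain_on (upper_koszul Q a) p.+1 g & simplicial_bd g =1 strand z a) ->
  exists2 w, koszul_chain Q p.+1 s d w & koszul_bd w =1 z.
Proof.
move=> zc zb.
have [G GP] : exists G : 'X_{1..n} -> {set 'I_n} -> K^o, forall a, (mdeg a + s)%N = d ->
    chain_on (upper_koszul Q a) p.+1 (G a) /\ simplicial_bd (G a) =1 strand z a.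
  have /fin_all_exists[G GP] : forall a : 'X_{1..n < d.+1}, exists g : {set 'I_n} -> K^o,
      (mdeg a + s)%N = d -> chain_on (upper_koszul Q a) p.+1 g /\ simplicial_bd g =1 strand
        z a.
    move=> a; case: (eqVneq (mdeg a + s)%N d) => [/zb[g gc gE]|/eqP ad]; first by exists g.
    by exists (fun=> 0).
  exists (fun a => if insub a is Some b then G b else fun=> 0) => a ad.
  have ad' : (mdeg a < d.+1)%N by rewrite -ad ltnS leq_addr.
  by rewrite (insubT (fun b : 'X_{1..n} => mdeg b < d.+1)%N ad') /=; apply: GP.
pose E t m : K := if (mdeg m + #|t| + s == d)%N then G (m + set_mnm t)%MM t else 0.
pose w t : S^o := \sum_(m : 'X_{1..n < d.+1}) E t m *: 'X_[m].
have wE t m : (w t)@_m = E t m.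
  case: (ltnP (mdeg m) d.+1) => md; first exact: mcoeff_mpoly.
  rewrite /E ifF; last by apply/eqP; lia.
  rewrite /w raddf_sum big1 // => i _ /=; rewrite mcoeffZ mcoeffX.
  by case: eqP => [im|]; rewrite ?mulr0 //; have := bmdeg i; rewrite im; lia.
exists w => [t m|t].
  rewrite mcoeff_msupp wE /E; case: (eqVneq (mdeg m + #|t| + s)%N d) => [md|_];
    last by rewrite eqxx.
  have /GP[Gc _] : (mdeg (m + set_mnm t) + s = d)%N by rewrite mdegD mdeg_set_mnm.
  by move=> /Gc/andP[/andP[_]]; rewrite addmK => -> /eqP <-.
apply/mpolyP=> m; pose a := (m + set_mnm t)%MM.
have coefE (y : {set 'I_n} -> S^o) : (y t)@_m = strand y a t.
  by rewrite /strand lem_addl addmK.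
rewrite !coefE -simplicial_bd_strand; case: (eqVneq (mdeg a + s)%N d) => [ad|ad].
  have [Gc <-] := GP a ad; apply: (@eq_boundary _ _ K^o) => u; rewrite /strand;
    case: ifP => ua.
    rewrite wE /E submK // ifT //; apply/eqP.
    by rewrite -mdeg_set_mnm -mdegD submK.
  by apply/esym/eqP; apply: contraFT ua => /Gc/andP[/andP[]].
rewrite /simplicial_bd boundary0 => [|u].
  rewrite -coefE; apply/esym/eqP; apply: contraNT ad.
  by rewrite -mcoeff_msupp => /zc[_ _ <-]; rewrite mdegD mdeg_set_mnm.
rewrite /strand; case: ifP => // ua; rewrite wE /E ifF //.
by apply: contraNF ad => /eqP <-; rewrite -mdeg_set_mnm -mdegD submK.
Qed.

(** In multidegree a <> 0 the strand is the full simplex on the support of a,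
    a cone.  The last hypothesis removes the class of 1 in multidegree 0. *)
Lemma koszul_exact p s d z : koszul_chain xpredT p s d z ->
    (forall t, koszul_bd z t = 0) -> (z set0)@_0%MM = 0 ->
  exists2 w, koszul_chain xpredT p.+1 s d w & koszul_bd w =1 z.
Proof.
move=> zc cz z0; apply: koszul_boundary_of_strands => // a _.
have [->|/eqP a0] := eqVneq a 0%MM.
  exists (fun=> 0) => [t|t]; first by rewrite eqxx.
  rewrite /simplicial_bd boundary0 // /strand; case: ifP => // /mnm_lepP t0.
  have -> : t = set0.
    by apply/setP=> i; have := t0 i; rewrite !mnmE inE; case: (i \in t).
  suff -> : (0 - set_mnm set0)%MM = 0%MM :> 'X_{1..n} by rewrite z0.
  by apply/mnmP=> i; rewrite !mnmE.
have [v av] : exists v, a v != 0%N.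
  apply/existsP; apply: contra_notT a0; rewrite negb_exists => /forallP a0.
  by apply/mnmP=> i; rewrite mnmE; have := a0 i; rewrite negbK => /eqP.
have ac : acyclic_at K (upper_koszul xpredT a) p.
  apply: (@acyclic_at_cone _ _ _ p v); rewrite /upper_koszul => t;
    rewrite !andbT => /mnm_lepP ta; apply/mnm_lepP=> i.
  have := ta i; rewrite !mnmE !inE; case: (i =P v) => //= -> _.
  by rewrite lt0n.
apply: ac; first exact: chain_strand zc.
by move=> t; rewrite simplicial_bd_strand /strand; case: ifP => // _; rewrite cz mcoeff0.
Qed.

Lemma koszul_boundary_of_acyclic Q p s d z : koszul_chain Q p s d z ->
    (forall t, koszul_bd z t = 0) ->
    (forall a, (mdeg a + s)%N = d -> acyclic_at K (upper_koszul Q a) p) ->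
  exists2 w, koszul_chain Q p.+1 s d w & koszul_bd w =1 z.
Proof.
move=> zc cz ac; apply: koszul_boundary_of_strands => // a /ac; apply.
  exact: chain_strand zc.
by move=> t; rewrite simplicial_bd_strand /strand; case: ifP => // _; rewrite cz mcoeff0.
Qed.

End Koszul.

(** * From minimal resolutions to Koszul homology *)

Section Zigzag.
Variables (K : fieldType) (n : nat).
Local Notation S := {mpoly K[n]}.
Implicit Types (t : {set 'I_n}) (a m : 'X_{1..n}).

Definition row_chain r (sh : 'I_r -> nat) p d (z : {set 'I_n} -> 'rV[S]_r) :=
  forall l, koszul_chain xpredT p (sh l) d (fun t => z t 0 l).

Lemma koszul_bd_entry r (z : {set 'I_n} -> 'rV[S]_r) l t :
  koszul_bd z t 0 l = koszul_bd (fun t => z t 0 l : S^o) t.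
Proof. by rewrite /koszul_bd /boundary summxE; apply: eq_bigr => v _; rewrite mxE. Qed.

Lemma koszul_bd_mulmx r r' (z : {set 'I_n} -> 'rV[S]_r) (D : 'M_(r, r')) t :
  koszul_bd z t *m D = koszul_bd (fun t => z t *m D) t.
Proof.
by rewrite /koszul_bd /boundary mulmx_suml; apply: eq_bigr => v _; rewrite scalemxAl.
Qed.

Lemma row_chain_mulmx r r' (sh : 'I_r -> nat) (sh' : 'I_r' -> nat)
    (D : 'M[S]_(r, r')) p d z :
    (forall l l', homog_shift (sh' l') (sh l) (D l l')) ->
  row_chain sh p d z -> row_chain sh' p d (fun t => z t *m D).
Proof.
move=> Dgr zc l' t m; rewrite mxE => /msupp_sum_le /flattenP[s /mapP[l _ ->]].
move=> /msuppM_le /allpairsP[[m1 m2] /= [/zc[_ -> dE] /Dgr shE ->]]; split=> //.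
by rewrite mdegD; lia.
Qed.

Lemma row_koszul_exact r (sh : 'I_r -> nat) p d z :
    row_chain sh p d z -> (forall t, koszul_bd z t = 0) ->
    (forall l, (z set0 0 l)@_0%MM = 0) ->
  exists2 w, row_chain sh p.+1 d w & koszul_bd w =1 z.
Proof.
move=> zc cz z0.
have /fin_all_exists2[w wc wE] : forall l, exists2 w : {set 'I_n} -> S^o,
    koszul_chain xpredT p.+1 (sh l) d w & koszul_bd w =1 (fun t => z t 0 l).
  move=> l; apply: koszul_exact; [exact: zc | | exact: z0].
  by move=> t; rewrite -koszul_bd_entry cz mxE.
exists (fun t => \row_l w l t) => [l t m|t].
  by rewrite mxE; apply: wc.
apply/rowP=> l; rewrite koszul_bd_entry -wE; by apply: (@eq_boundary _ _ S^o) => s;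
  rewrite mxE.
Qed.

(** The image of z under D is a Koszul cycle with values in the image of D, and it
    does not bound there: a nonzero class in the p-th Koszul homology of im D,
    lifted to the free module that maps onto im D. *)
Definition essential_cycle r r' (sh : 'I_r -> nat) (D : 'M[S]_(r, r')) p d z :=
  [/\ row_chain sh p d z, forall t, koszul_bd z t *m D = 0
    & ~ exists u : {set 'I_n} -> 'rV_r, forall t, (z t - koszul_bd u t) *m D = 0].

(** The connecting isomorphism for 0 -> im D1 -> F_1 -> im D0 -> 0.  Since the
    entries of D1 have no constant term, the cycle z D1 bounds some w in the Koszul
    complex of the free module F_1, and w is the new class.  Were w trivial modulo
    im D1, then z D1 would already bound inside im D1. *)
Lemma essential_cycle_shift r2 r1 r0 (sh2 : 'I_r2 -> nat) (sh1 : 'I_r1 -> nat)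
    (D1 : 'M[S]_(r2, r1)) (D0 : 'M[S]_(r1, r0)) p d z :
    (forall l l', homog_shift (sh1 l') (sh2 l) (D1 l l')) ->
    (forall l l', (D1 l l')@_0%MM = 0) ->
    (forall u : 'rV_r1, u *m D0 = 0 <-> exists v : 'rV_r2, u = v *m D1) ->
  essential_cycle sh2 D1 p d z -> exists w, essential_cycle sh1 D0 p.+1 d w.
Proof.
move=> Dgr Dmin ex [zc cz zess].
have [t|l|w wc wE] := row_koszul_exact (row_chain_mulmx Dgr zc).
- by rewrite -koszul_bd_mulmx cz.
- rewrite mxE raddf_sum big1 // => k _ /=.
  by rewrite [LHS](rmorphM (mcoeff 0%MM)) /= Dmin mulr0.
exists w; split=> // [t|[u uE]].
  by rewrite wE; apply/ex; exists (z t).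
have /fin_all_exists[y yE] : forall t, exists v : 'rV_r2, w t - koszul_bd u t = v *m D1.
  by move=> t; apply/ex.
apply: zess; exists y => t.
rewrite mulmxBl -wE koszul_bd_mulmx /koszul_bd -boundaryB.
have -> : boundary (fun v => 'X_v : S) (fun s => w s - y s *m D1) t =
          boundary (fun v => 'X_v : S) (koszul_bd u) t.
  by apply: eq_boundary => s; rewrite -yE opprB addrC subrK.
exact: boundary_boundary.
Qed.

Definition gf_target (F : graded_free_chain K n) i : nat :=
  if i is j.+1 then gf_rank F j else 1.

(** The augmentation is treated as the differential leaving F_0, so that the
    descent along the resolution is a uniform induction. *)
Definition gf_map (F : graded_free_chain K n) i : 'M[S]_(gf_rank F i, gf_target F i) :=
  if i is j.+1 then gf_diff F j else gf_aug F.

Section MonomialIdeal.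
Variables (I : S -> Prop) (F : graded_free_chain K n).
Hypothesis resF : minimal_graded_free_resolution I F.

Lemma gf_exact i (u : 'rV_(gf_rank F i)) :
  u *m gf_map F i = 0 <-> exists v, u = v *m gf_diff F i.
Proof. by case: i u => [|i]; [exact: (mgfr_exact0 resF) | exact: (mgfr_exactS resF)]. Qed.

(** A basis element of F_i is a minimal generator of its image: otherwise
    exactness and minimality would put it in (x_1, ..., x_n) F_i. *)
Lemma essential_cycle_generator i (l : 'I_(gf_rank F i)) :
  exists z, essential_cycle (@gf_shift _ _ F i) (gf_map F i) 0 (gf_shift l) z.
Proof.
exists (fun t => if t == set0 then delta_mx 0 l else 0); split=> [l' t m|t|[u /(_ set0)]].
- case: (eqVneq t set0) => [->|_]; rewrite mxE ?msupp0 //= cards0.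
  case: (eqVneq l' l) => [->|_]; last by rewrite msupp0.
  by rewrite msupp1 inE => /eqP ->; rewrite mdeg0.
- rewrite /koszul_bd /boundary big1 ?mul0mx // => v vt; rewrite ifF ?scaler0 //.
  by apply/eqP=> /setP/(_ v); rewrite !inE eqxx.
rewrite eqxx => /gf_exact[v /matrixP/(_ 0 l)/(congr1 (mcoeff 0%MM))/eqP].
rewrite !mxE !eqxx mcoeffB mcoeff1 eqxx koszul_bd_entry raddf_sum [X in _ - X]big1.
  rewrite subr0 [X in _ == X]raddf_sum big1 ?oner_eq0 // => k _ /=.
  by rewrite [LHS](rmorphM (mcoeff 0%MM)) /= (mgfr_minimal resF) mulr0.
move=> w _ /=; rewrite -[X in mcoeff _ X]/(sgn_ins w set0 * 'X_w * u (w |: set0) 0 l).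
rewrite -mulrA mcoeff_sgn_ins mcoeff_XM lep1mP mnm0E eqxx mulr0 //.
Qed.

Variable Q : pred 'X_{1..n}.
Hypothesis IQ : forall p, I p <-> forall m, m \in msupp p -> Q m.

Lemma no_essential_cycle_acyclic p d z :
    (forall a, mdeg a = d -> acyclic_at K (upper_koszul Q a) p) ->
  ~ essential_cycle (@gf_shift _ _ F 0) (gf_aug F) p d z.
Proof.
move=> ac [zc cz zess]; pose c t : S^o := (z t *m gf_aug F) 0 0.
have cc : koszul_chain Q p 0 d c.
  move=> t m mc; have [] := row_chain_mulmx (sh' := fun=> 0%N) _ zc mc.
    by move=> l l'; rewrite (ord1 l') => m1; exact: (mgfr_aug_graded resF).
  move=> _ -> ->; split=> //; apply: (IQ _).1 mc.
  by apply/(mgfr_aug_onto resF); exists (z t).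
have [|a|w wc wE] := koszul_boundary_of_acyclic cc.
- by move=> t; rewrite /c -(koszul_bd_entry (fun t => z t *m gf_aug F)) -koszul_bd_mulmx cz
  mxE.
- by rewrite addn0; apply: ac.
have /fin_all_exists[u uE] : forall t, exists u : 'rV_(gf_rank F 0), w t = (u *m gf_aug F) 0 0.
  by move=> t; apply/(mgfr_aug_onto resF)/IQ => m /wc[].
apply: zess; exists u => t; apply/rowP=> l; rewrite ord1 mulmxBl koszul_bd_mulmx.
rewrite mxE [X in _ + X]mxE koszul_bd_entry -/(c t) -wE [X in _ - X](eq_boundary _ (g := w)).
  by rewrite addrN mxE.
by move=> s; rewrite uE.
Qed.

(** Nonvanishing of the Betti number at (i, j) gives homology of some upper Koszul
    complex in multidegree of total degree j, at faces with i vertices. *)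
Lemma generator_not_acyclic i (l : 'I_(gf_rank F i)) :
  ~ (forall a, mdeg a = gf_shift l -> acyclic_at K (upper_koszul Q a) i).
Proof.
move=> ac; have [z zess] := essential_cycle_generator l.
suff descend p d w : (forall a, mdeg a = d -> acyclic_at K (upper_koszul Q a) (p + i)%N) ->
    ~ essential_cycle (@gf_shift _ _ F i) (gf_map F i) p d w by exact: (descend 0%N _ _ ac
      zess).
elim: i {l ac z zess} p w => [|i IH] p w ac wess.
  by apply: no_essential_cycle_acyclic wess => a ad; have := ac a ad; rewrite addn0.
have [y yess] := essential_cycle_shift (mgfr_diff_graded resF (i := i))
  (mgfr_minimal resF (i := i)) (@gf_exact i) wess.
by apply: IH yess => a ad; have := ac a ad; rewrite addnS.
Qed.

End MonomialIdeal.
End Zigzag.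

(** * Symbolic powers of cover ideals *)

Section EdgePowers.
Variables (K : fieldType) (n : nat) (i j : 'I_n).
Local Notation S := {mpoly K[n]}.
Implicit Types (p q : S) (m : 'X_{1..n}).

(** Membership of p in (x_i, x_j)^d, read off its monomials. *)
Definition edge_order_ge d p := forall m, m \in msupp p -> (d <= m i + m j)%N.

Lemma edge_order_ge_sum (T : eqType) (r : seq T) (F : T -> S) d :
  (forall x, edge_order_ge d (F x)) -> edge_order_ge d (\sum_(x <- r) F x).
Proof.
by move=> H m /msupp_sum_le /flattenP[s /mapP[x _ ->]]; apply: H.
Qed.

Lemma edge_order_geM c d p q :
  edge_order_ge c p -> edge_order_ge d q -> edge_order_ge (c + d) (p * q).
Proof.
move=> Hp Hq m /msuppM_le /allpairsP[[m1 m2] /= [/Hp h1 /Hq h2 ->]].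
by rewrite !mnmDE addnACA leq_add.
Qed.

Lemma edge_order_ge0 p : edge_order_ge 0 p. Proof. by []. Qed.

Lemma edge_order_ge_prime p : edge_prime i j p -> edge_order_ge 1 p.
Proof.
case=> r [g [a [gX ->]]]; apply: edge_order_ge_sum => l.
rewrite -[1%N]add0n; apply: edge_order_geM => [|m]; first exact: edge_order_ge0.
by case: (gX l) => ->; rewrite msuppX inE => /eqP ->; rewrite !mnm1E eqxx ?addn1.
Qed.

Lemma prod_edge_variables c k :
  \prod_(s < k) (if (s < c)%N then 'X_i else 'X_j) =
    'X_[(U_(i) *+ minn c k + U_(j) *+ (k - c))] :> S.
Proof.
elim: k => [|k IH]; first by rewrite big_ord0 minn0 sub0n mulm0n addm0 mpolyX0.
rewrite big_ord_recr /= IH.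
by case: ltnP => ck; rewrite -mpolyXD; congr 'X_[_]; apply/mnmP=> u;
  rewrite !mnmDE !mulmnE; move: (U_(i)%MM u) (U_(j)%MM u) => x y; nia.
Qed.

Lemma ideal_pow_edge_primeP k p : i != j ->
  ideal_pow (edge_prime i j) k p <-> edge_order_ge k p.
Proof.
move=> ij; split=> [[r [g [a [gP ->]]]]|ord_p].
  apply: edge_order_ge_sum => l; rewrite -[k]add0n.
  apply: edge_order_geM; first exact: edge_order_ge0.
  have [f [fP ->]] := gP l.
  have : forall s, edge_order_ge 1 (f s) by move=> s; apply: edge_order_ge_prime.
  elim: k f {gP fP} => [|k IH] f f1; first exact: edge_order_ge0.
  by rewrite big_ord_recl; apply: (@edge_order_geM 1) => //; apply: IH.
pose mon l := nth 0%MM (msupp p) l.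
pose gen m := (U_(i) *+ minn (m i) k + U_(j) *+ (k - m i))%MM.
exists (size (msupp p)), (fun l => \prod_(s < k) (if (s < mon l i)%N then 'X_i else 'X_j)),
  (fun l => p@_(mon l) *: 'X_[(mon l - gen (mon l))]); split=> [l|].
  exists (fun s : 'I_k => if (s < mon l i)%N then 'X_i else 'X_j); split=> // s.
  exists 1%N, (fun=> if (s < mon l i)%N then 'X_i else 'X_j), (fun=> 1).
  by rewrite big_ord1 mul1r; split=> // _; case: ifP; [left | right].
rewrite [LHS]mpolyE (big_nth 0%MM) big_mkord; apply: eq_bigr => l _.
rewrite prod_edge_variables -scalerAl -mpolyXD submK //; apply/mnm_lepP=> u.
have := ord_p _ (mem_nth 0%MM (ltn_ord l)); rewrite -/(mon l).
rewrite mnmDE !mulmnE !mnm1E; case: eqP => [<-|_]; case: eqP => [ji|_] /=; try lia.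
- by rewrite ji eqxx in ij.
- by rewrite ji; lia.
Qed.

End EdgePowers.

Section CoverComplex.
Variables (n : nat) (e : rel 'I_n) (k : nat).
Hypotheses (e_sym : ssrbool.symmetric e) (e_irr : irreflexive e).

Definition cover_monomial (m : 'X_{1..n}) : bool :=
  [forall i, forall j, e i j ==> (k <= m i + m j)%N].

Lemma cover_monomialP (m : 'X_{1..n}) :
  reflect (forall i j, e i j -> (k <= m i + m j)%N) (cover_monomial m).
Proof.
apply: (iffP forallP) => H i; first by move=> j; apply/implyP; move/forallP: (H i); apply.
by apply/forallP=> j; apply/implyP/H.
Qed.

Lemma cover_symbolic_powerP (K : fieldType) (p : {mpoly K[n]}) :
  cover_ideal_symbolic_power e K k p <-> forall m, m \in msupp p -> cover_monomial m.
Proof.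
have ne i j : e i j -> i != j by apply: contraTneq => ->; rewrite e_irr.
split=> [pJ m mp|H i j eij].
  by apply/cover_monomialP=> i j eij; apply: (ideal_pow_edge_primeP _ _ (ne _ _ eij)).1 mp;
    apply: pJ.
by apply/ideal_pow_edge_primeP => [|m /H /cover_monomialP]; [apply: ne | apply].
Qed.

(** The vertices v for which X^(a - v) is still a monomial of the symbolic power,
    that is, the vertices of the upper Koszul complex. *)
Definition slack_vertices (a : 'I_n -> nat) : {set 'I_n} :=
  [set v | (0 < a v)%N && [forall u, e v u ==> (k < a v + a u)%N]].

(** Between slack vertices these are the edges uv for which X^(a - u - v) is no
    longer a monomial of the symbolic power. *)
Definition almost_tight (a : 'I_n -> nat) : rel 'I_n :=
  [rel u v | e u v && (a u + a v == k.+1)%N].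

Lemma slack_verticesP (a : 'I_n -> nat) v :
  reflect (0 < a v /\ forall u, e v u -> k < a v + a u)%N (v \in slack_vertices a).
Proof.
rewrite inE; apply: (iffP andP) => -[av H]; split=> //.
  by move=> u; move/forallP/(_ u)/implyP: H.
by apply/forallP=> u; apply/implyP/H.
Qed.

Lemma upper_koszul_cover (a : 'X_{1..n}) t : cover_monomial a ->
  upper_koszul cover_monomial a t = ind_complex (almost_tight a) (slack_vertices a) t.
Proof.
move=> /cover_monomialP ca; apply/andP/andP => [[/mnm_lepP ta /cover_monomialP Q]|[/subsetP
  tW It]].
  have a0 v : v \in t -> (0 < a v)%N by move=> vt; have := ta v; rewrite mnmE vt.
  split.
    apply/subsetP=> v vt; apply/slack_verticesP; split=> [|u vu]; first exact: a0.
    by have := Q v u vu; have := a0 v vt; rewrite !mnmBE !mnmE vt; lia.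
  apply/'forall_implyP=> u ut; apply/'forall_implyP=> v vt; apply/negP=> /andP[uv /eqP s].
  have := Q u v uv; have := a0 u ut; have := a0 v vt; rewrite !mnmBE !mnmE ut vt; lia.
have H u v : u \in t -> v \in t -> e u v -> (a u + a v != k.+1)%N.
  move=> ut vt uv; move/'forall_implyP/(_ u ut)/'forall_implyP/(_ v vt): It.
  by rewrite negb_and uv.
split.
  apply/mnm_lepP=> v; rewrite mnmE; case: (boolP (v \in t)) => // /tW.
  by case/slack_verticesP.
apply/cover_monomialP=> u v uv; rewrite !mnmBE !mnmE; have := ca u v uv.
case: (boolP (u \in t)) => ut; case: (boolP (v \in t)) => vt; rewrite ?subn0 //.
- have := H u v ut vt uv; have /slack_verticesP[au /(_ v uv)] := tW u ut.
  by have /slack_verticesP[av _] := tW v vt; lia.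
- by have /slack_verticesP[au /(_ v uv)] := tW u ut; lia.
- by rewrite e_sym in uv; have /slack_verticesP[av /(_ u uv)] := tW v vt; lia.
Qed.

End CoverComplex.

(** * Fractional covers and the invariant gamma *)

Section Gamma.
Variables (n : nat) (e : rel 'I_n).
Hypothesis e_sym : ssrbool.symmetric e.
Implicit Types (A B W : {set 'I_n}).

Lemma open_nbhdP A y : reflect (exists2 x, x \in A & e x y) (y \in open_nbhd e A).
Proof.
rewrite inE; apply: (iffP existsP) => [[x /andP[xA xy]]|[x xA xy]]; exists x => //.
by rewrite xA.
Qed.

Lemma independentP A :
  reflect (forall x y, x \in A -> y \in A -> ~~ e x y) (independent e A).
Proof.
apply: (iffP 'forall_implyP) => [H x y xA yA|H x xA].
  by move/'forall_implyP: (H x xA); apply.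
by apply/'forall_implyP=> y yA; apply: H.
Qed.

Lemma in_component W x y : x \in W -> y \in component e W x -> y \in W.
Proof.
move=> xW; rewrite inE => /connectP[p]; elim: p x xW => [|z p IH] x xW /=.
  by move=> _ ->.
by case/andP=> /and3P[_ zW _] /IH; apply.
Qed.

Lemma component_adj W x y z : y \in component e W x -> y \in W -> z \in W -> e y z ->
  z \in component e W x.
Proof.
rewrite !inE => xy yW zW yz; apply: connect_trans xy (connect1 _).
by rewrite /induced /= yW zW.
Qed.

(** The absence of bipartite components may be weakened to the absence of isolated
    vertices: a bipartite component with sides C1, C2, |C1| <= |C2|, is absorbed by
    adding C1 to A, which puts C2 into the neighbourhood and does not decrease
    the value. *)
Lemma gamma_ge A : independent e A ->
    (forall x, x \in ~: closed_nbhd e A ->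
       exists2 y, y \in ~: closed_nbhd e A & e x y) ->
  (n%:R + #|open_nbhd e A|%:R - #|A|%:R) / 2 <= gamma e.
Proof.
have [m] := ubnP #|~: closed_nbhd e A|; elim: m => // m IH in A *.
rewrite ltnS => Am Aind; set R := ~: closed_nbhd e A => Riso.
case: (boolP (no_bipartite_component e R)) => [nb|].
  apply: (le_bigmax_cond _ (P := fun A => independent e A &&
    no_bipartite_component e (~: closed_nbhd e A))
    (fun A => (n%:R + #|open_nbhd e A|%:R - #|A|%:R) / 2 : rat)).
  by rewrite Aind.
rewrite negb_forall_in => /'exists_andP[x [xR]]; rewrite negbK.
set C := component e R x => /existsP[B /'forall_implyP Bbip].
have bip u v : u \in C -> v \in C -> e u v -> (u \in B) != (v \in B).
  by move=> uC vC; apply/implyP; move/'forall_implyP: (Bbip u uC); apply.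
have CR u : u \in C -> u \in R by apply: in_component.
have [C1 [C2 [C1C C2C C12 bip12 C12E]]] : exists C1 C2 : {set 'I_n},
    [/\ C1 \subset C, C2 \subset C, (#|C1| <= #|C2|)%N,
      (forall u v, u \in C -> v \in C -> e u v -> (u \in C1) = (v \in C2))
      & (forall u, u \in C -> (u \in C1) = (u \notin C2))].
  case: (leqP #|C :&: B| #|C :\: B|) => le_card;
    [exists (C :&: B), (C :\: B) | exists (C :\: B), (C :&: B)].
  - split; rewrite ?subsetIl ?subsetDl ?(ltnW le_card) //.
      move=> u v uC vC uv; have := bip u v uC vC uv.
      by rewrite !(in_setI, in_setD) uC vC /= ?andbT; case: (u \in B); case: (v \in B).
    by move=> u uC; rewrite !(in_setI, in_setD) uC /= ?andbT ?negbK.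
  - split; rewrite ?subsetIl ?subsetDl ?(ltnW le_card) //.
      move=> u v uC vC uv; have := bip u v uC vC uv.
      by rewrite !(in_setI, in_setD) uC vC /= ?andbT; case: (u \in B); case: (v \in B).
    by move=> u uC; rewrite !(in_setI, in_setD) uC /= ?andbT ?negbK.
have nR u : u \in R -> u \notin A /\ u \notin open_nbhd e A.
  by rewrite in_setC inE negb_or => /andP[].
have C2N u : u \in C2 -> u \in open_nbhd e (A :|: C1).
  move=> uC2; have uC := subsetP C2C u uC2; have [v vR uv] := Riso u (CR u uC).
  have vC : v \in C by apply: component_adj uv => //; apply: CR.
  apply/open_nbhdP; exists v; last by rewrite e_sym.
  by rewrite inE (bip12 v u) ?uC2 ?orbT // e_sym.
have NA u : u \in open_nbhd e A -> u \in open_nbhd e (A :|: C1).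
  by case/open_nbhdP=> y yA yu; apply/open_nbhdP; exists y; rewrite // inE yA.
apply: le_trans (IH (A :|: C1) _ _ _).
- have dAC : [disjoint A & C1].
    rewrite -setI_eq0; apply/eqP/setP=> u; rewrite !inE; apply/negP=> /andP[uA uC1].
    by have [/negP] := nR u (CR u (subsetP C1C u uC1)).
  have dNC : [disjoint open_nbhd e A & C2].
    rewrite -setI_eq0; apply/eqP/setP=> u; rewrite in_setI in_set0; apply/negP=> /andP[uN uC2].
    by have [_ /negP] := nR u (CR u (subsetP C2C u uC2)).
  have /subset_leq_card : open_nbhd e A :|: C2 \subset open_nbhd e (A :|: C1).
    by apply/subsetP=> u; rewrite in_setU => /orP[/NA|/C2N].
  rewrite cardsU disjoint_setI0 // cards0 subn0.
  rewrite [#|A :|: C1|]cardsU disjoint_setI0 // cards0 subn0 => leN.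
  have : (#|open_nbhd e A| + #|A| + #|C1| <= #|open_nbhd e (A :|: C1)| + #|A|)%N by lia.
  rewrite -(ler_nat rat) !natrD; lra.
- apply: leq_trans Am; apply: proper_card; apply/properP; split.
    rewrite setCS; apply/subsetP=> u; rewrite !in_setU => /orP[/NA ->//|->]; by rewrite orbT.
  exists x => //; have xC : x \in C by rewrite inE connect0.
  rewrite in_setC negbK in_setU in_setU; case: (boolP (x \in C1)) => [_|]; rewrite ?orbT //.
  by rewrite C12E // negbK => /C2N ->.
- apply/independentP=> u v; rewrite !in_setU => /orP[uA|uC1] /orP[vA|vC1].
  + by move/independentP: Aind; apply.
  + have [_] := nR v (CR v (subsetP C1C v vC1)); apply: contraNN => uv.
    by apply/open_nbhdP; exists u.
  + have [_] := nR u (CR u (subsetP C1C u uC1)); apply: contraNN => uv.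
    by apply/open_nbhdP; exists v; rewrite // e_sym.
  + apply/negP=> uv; have uC := subsetP C1C u uC1; have vC := subsetP C1C v vC1.
    by move: (bip12 u v uC vC uv); rewrite uC1; move: vC1; rewrite C12E // => /negbTE ->.
- move=> u; rewrite in_setC in_setU negb_or => /andP[uN].
  rewrite in_setU negb_or => /andP[uA uC1].
  have uR : u \in R by rewrite in_setC in_setU negb_or uA andbT; apply: contraNN uN => /NA.
  have uC : u \notin C.
    by apply: contraNN uN => uC; apply: C2N; apply: contraNT uC1; rewrite C12E.
  have [v vR uv] := Riso u uR; exists v => //.
  have vC : v \notin C by apply: contraNN uC => vC; apply: component_adj vC _ uR _;
    rewrite // e_sym.
  have [vA vN] := nR v vR.
  rewrite in_setC !in_setU !negb_or vA /=; apply/andP; split; last first.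
    by apply: contraNN vC; apply: (subsetP C1C).
  apply/open_nbhdP=> -[w]; rewrite in_setU => /orP[wA wv|wC1 wv].
    by case/open_nbhdP: vN; exists w.
  have wC := subsetP C1C w wC1.
  by case/negP: vC; apply: component_adj wC (CR w wC) vR wv.
Qed.

Lemma card_set_sum (P : pred 'I_n) : #|[set v | P v]| = (\sum_v P v)%N.
Proof. by rewrite -sum1dep_card big_mkcond; apply: eq_bigr => v _; case: (P v). Qed.

Lemma sum_ltn_ord m c : (\sum_(t < m) (c <= t) = m - c)%N.
Proof.
elim: m => [|m IH]; first by rewrite big_ord0.
by rewrite big_ord_recr /= IH; case: leqP; lia.
Qed.

(** Here X = 2x for a half-integral point x.  For each threshold t < m round x to
    m * 0, m * 1/2 or m * 1 according to X <= t, t < X < 2m - t or X >= 2m - t.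
    The sets A t of vertices rounded to 0 are independent, with neighbourhood the
    vertices rounded to m, so each rounding has total at most m gamma; and the
    average over t of the roundings is x. *)
Lemma tight_cover_le_gamma (X : 'I_n -> nat) m :
    (forall u v, e u v -> m.*2 <= X u + X v)%N ->
    (forall v, X v = 0%N \/ exists2 u, e v u & (X v + X u = m.*2)%N) ->
  (\sum_v X v)%:R / 2 <= m%:R * gamma e.
Proof.
move=> Xge Xtight.
have Xle v : (X v <= m.*2)%N by case: (Xtight v) => [->//|[u _ <-]]; rewrite leq_addr.
pose A (t : 'I_m) := [set v | (X v <= t)%N].
have NE t : open_nbhd e (A t) = [set v | (m.*2 - t <= X v)%N].
  apply/setP=> v; rewrite [RHS]inE; apply/open_nbhdP/idP => [[u]|tv].
    by rewrite inE => ut /Xge; lia.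
  have tm := ltn_ord t; case: (Xtight v) => [v0|[u vu uv]]; first lia.
  by exists u; rewrite ?inE 1?e_sym //; lia.
have Age t : (n%:R + #|open_nbhd e (A t)|%:R - #|A t|%:R) / 2 <= gamma e.
  apply: gamma_ge.
    apply/independentP=> u v; rewrite !inE => ut vt; apply/negP=> /Xge.
    have := ltn_ord t; lia.
  move=> v; rewrite in_setC in_setU negb_or NE !inE => /andP[vN vA].
  case: (Xtight v) => [v0|[u vu uv]]; first by rewrite v0 in vA.
  by exists u => //; rewrite in_setC in_setU negb_or NE !inE; lia.
(* The averaging identity: for X_v <= 2m, the number of t < m with 2m - t <= X_v
   minus the number of those with X_v <= t is X_v - m. *)
have /eqP cardE : (m * n + \sum_(t < m) #|open_nbhd e (A t)| ==
               \sum_v X v + \sum_(t < m) #|A t|)%N.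
  rewrite (eq_bigr _ (fun t _ => congr1 (fun B : {set 'I_n} => #|B|) (NE t))).
  rewrite (eq_bigr _ (fun t _ => card_set_sum _)).
  rewrite [X in _ == (_ + X)%N](eq_bigr _ (fun t _ => card_set_sum _)).
  rewrite exchange_big [X in _ == (_ + X)%N]exchange_big /=.
  rewrite mulnC -[X in (X * m)%N]card_ord -sum_nat_const -!big_split /=.
  apply/eqP; apply: eq_bigr => v _; have := Xle v.
  rewrite sum_ltn_ord (eq_bigr (fun t : 'I_m => nat_of_bool (m.*2 - X v <= t))%N) => [|t _].
    by rewrite sum_ltn_ord; lia.
  by have := ltn_ord t; have := Xle v; rewrite /=; case: leqP; case: leqP; lia.
have : \sum_(t < m) (n%:R + #|open_nbhd e (A t)|%:R - #|A t|%:R) / 2 <= \sum_(t < m) gamma e.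
  by apply: ler_sum => t _.
rewrite sumr_const card_ord -mulr_suml big_split big_split /= sumrN -!natr_sum sum_nat_const.
rewrite card_ord natrM.
have := congr1 (fun x : nat => x%:R : rat) cardE; rewrite /= !natrD natrM.
rewrite -[gamma e *+ m]mulr_natl; lra.
Qed.

End Gamma.

(** * The degree bound and the regularity *)

Section DegreeBound.
Variables (n : nat) (e : rel 'I_n).
Hypotheses (e_sym : ssrbool.symmetric e) (e_irr : irreflexive e).
Implicit Types (P Y : {set 'I_n}).

Lemma in_star (v y : 'I_n) : (y \in closed_nbhd e [set v]) = (y == v) || e v y.
Proof.
rewrite in_setU in_set1 orbC; congr (_ || _).
by apply/open_nbhdP/idP => [[x /set1P ->]|vy] //; exists v; rewrite ?set11.
Qed.

Lemma star_packingP P : reflect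
  (forall u v w, u \in P -> v \in P -> (w == u) || e u w -> (w == v) || e v w -> u = v)
  (star_packing e P).
Proof.
apply: (iffP 'forall_implyP) => [H u v w uP vP wu wv|H u uP].
  apply/eqP/negP => /negP uv; move/'forall_implyP/(_ v vP): (H u uP).
  rewrite uv /= => /pred0P/(_ w) /=; by rewrite !in_star wu wv.
apply/'forall_implyP=> v vP; apply/implyP; apply: contraR => /pred0Pn[w /andP[/=]].
by rewrite !in_star => wu wv; apply/eqP/(H u v w).
Qed.

(** The stars are disjoint, so their traces on Y add up. *)
Lemma star_packing_card_le P P' Y c : star_packing e P -> P' \subset P ->
    (forall v, v \in P' -> c <= #|closed_nbhd e [set v] :&: Y|)%N ->
  (c * #|P'| <= #|Y|)%N.
Proof.
move=> /star_packingP packP /subsetP P'P cP.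
have : (\sum_(v in P') c <= \sum_(v in P') \sum_(y in Y) (y \in closed_nbhd e [set v]))%N.
  apply: leq_sum => v /cP /leq_trans; apply; rewrite -sum1_card big_mkcond [leqRHS]big_mkcond.
  by apply: leq_sum => y _; rewrite !inE; case: (y \in Y); rewrite ?andbF //= ?andbT;
    case: ifP.
rewrite sum_nat_const mulnC => /leq_trans; apply.
rewrite exchange_big -sum1_card; apply: leq_sum => y _.
case: (boolP [exists v in P', y \in closed_nbhd e [set v]]) => [/'exists_andP[v [vP yv]]|no].
  rewrite (bigD1 v) //= big1 ?addn0 ?leq_b1 // => u /andP[uP uv].
  case: (boolP (y \in _)) => // yu; move: yu yv; rewrite !in_star => yu yv.
  by rewrite (packP u v y) ?eqxx ?P'P in uv.
rewrite big1 // => v vP; apply/eqP; rewrite eqb0; apply: contraNN no => yv.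
by apply/existsP; exists v; rewrite vP.
Qed.

Lemma card_sum_mem (A : {set 'I_n}) : #|A| = (\sum_v (v \in A))%N.
Proof. by rewrite -sum1_card big_mkcond; apply: eq_bigr => v _; case: (v \in A). Qed.

(** Z is the zero set of a, NZ its neighbourhood, and T what is left outside
    W = slack_vertices; a = k on NZ, and T is covered by edges inside T with sum k.
    The point X is twice the point x of the introduction. *)
Lemma koszul_degree_le (a : 'I_n -> nat) k i P : (0 < k)%N ->
    (forall u v, e u v -> k <= a u + a v)%N ->
    (forall w, w \in slack_vertices e k a ->
       exists2 u, u \in slack_vertices e k a & almost_tight e k a w u) ->
    star_packing e P -> (#|P :&: slack_vertices e k a| <= i)%N ->
  (\sum_v a v)%:R - i%:R <= (k%:R - 1) * gamma e + n%:R - #|P|%:R :> rat.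
Proof.
move=> k0 age Wtight packP Pi; set W := slack_vertices e k a in Wtight Pi.
pose Z := [set v | a v == 0%N]; pose NZ := open_nbhd e Z.
pose T := ~: (Z :|: NZ :|: W).
have NZP v : reflect (exists2 z, a z = 0%N & e z v) (v \in NZ).
  by apply: (iffP (open_nbhdP _ _ _)) => -[z]; rewrite ?inE => /eqP az zv; exists z;
    rewrite ?inE.
have WP v : v \in W -> (0 < a v)%N /\ forall u, e v u -> (k < a v + a u)%N.
  by move/slack_verticesP.
have WN v : (0 < a v)%N -> v \notin W -> exists2 u, e v u & (a v + a u = k)%N.
  rewrite inE => -> /=; rewrite negb_forall => /existsP[u]; rewrite negb_imply -leqNgt.
  by case/andP=> vu le_k; exists u => //; have := age v u vu; lia.
have NZW v : v \in NZ -> v \notin W.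
  case/NZP=> z az zv; apply/negP=> vW; have [_ /(_ z)] := WP v vW.
  have [u uW /andP[_ /eqP]] := Wtight v vW; have [au _] := WP u uW.
  by rewrite az e_sym => s /(_ zv); lia.
have NZk v : v \in NZ -> a v = k.
  move=> vN; have [z az zv] := NZP v vN; have := age z v zv; rewrite az add0n => kv.
  have [||u _] := WN v; [lia | exact: NZW | lia].
have TP v : v \in T -> [/\ (0 < a v)%N, v \notin NZ, v \notin W
    & exists2 u, u \in T & e v u /\ (a v + a u = k)%N].
  rewrite in_setC !in_setU !negb_or => /andP[/andP[vZ vN] vW].
  have av : (0 < a v)%N by move: vZ; rewrite inE lt0n.
  split=> //.
  have [u vu s] := WN v av vW; exists u => //.
  rewrite !in_setC !in_setU !negb_or; apply/andP; split; [apply/andP; split|].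
  - rewrite inE; apply/eqP=> au; case/negP: vN; apply/NZP; exists u => //; by rewrite e_sym.
  - by apply/negP=> /NZk au; lia.
  - by apply/negP=> /WP[_ /(_ v)]; rewrite e_sym => /(_ vu); lia.
pose X v := if v \in Z then 0%N else if v \in T then ((a v).*2.-1)%N else (a v).-1.*2.
have cls v : [\/ [/\ a v = 0, X v = 0 & (v \in Z) + (v \in NZ) + (v \in W) + (v \in T) = 1]%N,
   [/\ v \in NZ, a v = k, X v = k.-1.*2 & [/\ v \notin Z, v \notin W & v \notin T]],
   [/\ v \in W, (0 < a v)%N, X v = (a v).-1.*2 & [/\ v \notin Z, v \notin NZ & v \notin T]]
 | [/\ v \in T, (0 < a v)%N, X v = (a v).*2.-1 & [/\ v \notin Z, v \notin NZ & v \notin W]]].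
  have ZE : (v \in Z) = (a v == 0%N) by rewrite inE.
  have TE : (v \in T) = ~~ [|| v \in Z, v \in NZ | v \in W] by rewrite in_setC !in_setU orbA.
  rewrite /X; case: (boolP (v \in NZ)) => vN.
    have vW := NZW v vN; have av := NZk v vN.
    have vZ : v \notin Z by rewrite ZE av -lt0n.
    apply: Or42; rewrite TE (negbTE vZ) vN /= av vW; split=> //.
  case: (boolP (v \in Z)) => vZ.
    apply: Or41; rewrite TE vZ /=; split=> //; first by apply/eqP; rewrite -ZE.
    by case: (boolP (v \in W)) => // /WP[]; rewrite lt0n -ZE vZ.
  have av : (0 < a v)%N by rewrite lt0n -ZE.
  case: (boolP (v \in W)) => vW; [apply: Or43|apply: Or44];
    by rewrite TE (negbTE vZ) (negbTE vN) ?vW ?(negbTE vW).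
have Xge u v : e u v -> (k.-1.*2 <= X u + X v)%N.
  move=> uv; have := age u v uv; have vu : e v u by rewrite e_sym.
  have [[au Xu _]|[uN au Xu _]|[uW au Xu _]|[uT au Xu _]] := cls u;
  have [[av Xv _]|[vN av Xv _]|[vW av Xv _]|[vT av Xv _]] := cls v; rewrite Xu Xv => s;
    try lia.
  - by have [_ /(_ v uv)] := WP u uW; lia.
  - by have [_ /(_ v uv)] := WP u uW; lia.
  - by have [_ /(_ u vu)] := WP v vW; lia.
have Xtight v : X v = 0%N \/ exists2 u, e v u & (X v + X u = k.-1.*2)%N.
  have [[_ Xv _]|[vN av Xv _]|[vW av Xv _]|[vT av Xv _]] := cls v; first (by left); right.
  - have [z az zv] := NZP v vN; exists z; first by rewrite e_sym.
    by rewrite Xv /X inE az /= addn0.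
  - have [u uW /andP[vu /eqP s]] := Wtight v vW; exists u => //; have [au _] := WP u uW.
    have [[au0 Xu _]|[uN _ _ _]|[_ _ Xu _]|[uT _ _ [_ _ uW']]] := cls u; try lia.
    + by have := NZW u uN; rewrite uW.
  - have [_ _ _ [u uT [vu s]]] := TP v vT; have [au uN uW _] := TP u uT; exists u => //.
    have [[au0 Xu _]|[uN' _ _ _]|[uW' _ _ _]|[_ _ Xu _]] := cls u; try lia.
have := tight_cover_le_gamma e_sym Xge Xtight.
(* The classes Z, NZ, W and T partition the vertices. *)
have nE : (n = #|Z| + #|NZ| + #|W| + #|T|)%N.
  rewrite !card_sum_mem -!big_split -[LHS]card_ord -sum1_card; apply: eq_bigr => v _ /=.
  by have [[_ _ ->]|[-> _ _ [/negbTE-> /negbTE-> /negbTE->]]|[-> _ _ [/negbTE-> /negbTE->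
    /negbTE->]]|[-> _ _ [/negbTE-> /negbTE-> /negbTE->]]] := cls v.
have aE : (2 * \sum_v a v = \sum_v X v + 2 * #|NZ| + 2 * #|W| + #|T|)%N.
  rewrite !card_sum_mem !big_distrr -!big_split; apply: eq_bigr => v _ /=.
  have [[av -> s]|[-> -> -> [_ /negbTE-> /negbTE->]]|[-> av -> [_ /negbTE-> /negbTE->]]|[->
    av -> [_ /negbTE-> /negbTE->]]] := cls v; try lia.
  have vZ : v \in Z by rewrite inE av.
  by move: s; rewrite av vZ; case: (v \in NZ); case: (v \in W); case: (v \in T).
have PE : (#|P| <= #|P :&: W| + #|P :&: T| + #|P :&: (Z :|: NZ)|)%N.
  rewrite !card_sum_mem -!big_split; apply: leq_sum => v _ /=; rewrite !in_setI;
    case: (v \in P) => //=.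
  by rewrite [v \in T]in_setC !in_setU; case: (v \in W); case: (v \in Z); case: (v \in NZ).
have PT : (2 * #|P :&: T| <= #|T|)%N.
  apply: (star_packing_card_le packP) => [|v /setIP[_ vT]]; first exact: subsetIl.
  have [_ _ _ [u uT [vu _]]] := TP v vT.
  have vu' : v != u by apply: contraTneq vu => ->; rewrite e_irr.
  have -> : 2%N = #|[set v; u]| by rewrite cards2 vu'.
  apply: subset_leq_card; apply/subsetP=> x; rewrite !in_setI in_star in_set2.
  by case/orP=> /eqP ->; rewrite ?eqxx ?vu ?orbT ?vT ?uT.
have PZ : (1 * #|P :&: (Z :|: NZ)| <= #|Z|)%N.
  apply: (star_packing_card_le packP) => [|v /setIP[_]]; first exact: subsetIl.
  rewrite in_setU card_gt0 => /orP[vZ|/NZP[z az zv]]; apply/set0Pn.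
    by exists v; rewrite in_setI in_star eqxx vZ.
  by exists z; rewrite in_setI in_star e_sym zv orbT inE az.
have {PE PT PZ Pi nE} : (2 * #|P| + 2 * #|NZ| + 2 * #|W| + #|T| <= 2 * i + 2 * n)%N by lia.
rewrite -(ler_nat rat) !natrD => b1.
have := congr1 (fun x : nat => x%:R : rat) aE; rewrite /= !natrD.
have -> : k.-1%:R = k%:R - 1 :> rat by rewrite -subn1 natrB.
lra.
Qed.

Lemma star_packing_numberP :
  exists2 P, star_packing e P & star_packing_number e = #|P|.
Proof.
have pack0 : (0 < #|star_packing e|)%N.
  apply/card_gt0P; exists set0; apply/star_packingP => u v w; by rewrite inE.
by have [P packP E] := eq_bigmax_cond (fun P => #|P|) pack0; exists P.
Qed.

End DegreeBound.

Theorem theorem3p5 (K : fieldType) (n : nat) (e : rel 'I_n)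
    (e_sym : ssrbool.symmetric e) (e_irr : irreflexive e)
    (k : nat) (k_ge1 : (1 <= k)%N)
    (r : int) (reg_r : is_regularity (cover_ideal_symbolic_power e K k) r) :
  r%:~R <= (k%:R - 1) * gamma e + n%:R - (star_packing_number e)%:R :> rat.
Proof.
case: reg_r => F [resF [i [j [betti ->]]] _]; have [P packP ->] := star_packing_numberP e.
have [l lj] : exists l : 'I_(gf_rank F i), gf_shift l = j.
  move/eqP: betti; rewrite cards_eq0 => /set0Pn[l]; rewrite inE => /eqP; by exists l.
rewrite leNgt; apply/negP=> above.
apply: (generator_not_acyclic resF (cover_symbolic_powerP k e_irr (K := K)) (l := l)) => a.
rewrite lj => aj; case: (boolP (cover_monomial e k a)) => [ca|nca]; last first.
  apply: acyclic_at_empty => t; apply: contraNN nca => /andP[_ /cover_monomialP c].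
  by apply/cover_monomialP=> u v /c; rewrite !mnmBE; lia.
pose W := slack_vertices e k a; pose h := almost_tight e k a.
apply: (@eq_acyclic_at _ _ (ind_complex h W)) => [t|]; first by rewrite upper_koszul_cover.
have hs : ssrbool.symmetric h by move=> u v; rewrite /h /almost_tight /= e_sym addnC.
have hi : irreflexive h by move=> u; rewrite /h /almost_tight /= e_irr.
case: (boolP [forall w in W, exists u in W, h w u]) => [/'forall_implyP cov|]; last first.
  rewrite negb_forall_in => /'exists_andP[v [vW]]; rewrite negb_exists => /forallP iso.
  apply: (acyclic_ind_complex_isolated hs hi vW) => u uW; by have := iso u; rewrite uW.
case: (ltnP i #|P :&: W|) => [iP|Pi].
  apply: (acyclic_ind_complex_packing hs hi _ _ iP); first exact: subsetIr.
  move=> u v w /setIP[uP _] /setIP[vP _] _ wu wv; apply: (star_packingP e P packP u v w) => //.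
    by case/orP: wu => [->|/andP[-> _]]; rewrite ?orbT.
  by case/orP: wv => [->|/andP[-> _]]; rewrite ?orbT.
have := koszul_degree_le e_sym e_irr k_ge1 (cover_monomialP _ _ _ ca) _ packP Pi.
rewrite -mdegE aj => bound; move: above; rewrite ltNge rmorphB /= bound //.
by move=> w /cov /'exists_andP[u [uW wu]]; exists u.
Qed.
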